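(* For every number of electrons $N\ge 2$ and any potential $v\in L^{3/2}(\mathbb{R}^3)+L^\infty(\mathbb{R}^3)$, the density functional model with electron-electron interaction energy given by the optimal transportation functional $E_{OT}$ is a rigorous lower bound to the exact ground state energy: $$E_0^{QM}\ \ge\ E_0^{DFT-OT}.$$
   Context: Let $\mathcal{A}$ be the set of $\Psi\in L^2((\mathbb{R}^3\times\mathbb{Z}_2)^N;\mathbb{C})$ with $\nabla\Psi\in L^2$ (gradient in the position variables), $\|\Psi\|_{L^2}=1$, and $\Psi$ antisymmetric, i.e. $\Psi(z_{\sigma(1)},\dots,z_{\sigma(N)})=\mathrm{sgn}(\sigma)\Psi(z_1,\dots,z_N)$ for all permutations $\sigma$, where $z_i=(x_i,s_i)\in\mathbb{R}^3\times\mathbb{Z}_2$ and $\int dz_i=\sum_{s_i\in\mathbb{Z}_2}\int_{\mathbb{R}^3}dx_i$. The potential $v$ is real-valued. For $\Psi\in\mathcal{A}$ put $\rho_N^\Psi(x_1,\dots,x_N)=\sum_{s_1,\dots,s_N}|\Psi(x_1,s_1,\dots,x_N,s_N)|^2$, the pair density $\rho_2^\Psi(x_1,x_2)=\binom N2\int\rho_N^\Psi\,dx_3\cdots dx_N$, and the single-particle density $\rho^\Psi(x_1)=N\int\rho_N^\Psi\,dx_2\cdots dx_N$. Let $$T[\Psi]=\tfrac12\int\cdots\int\sum_{i=1}^N|\nabla_{x_i}\Psi|^2\,dz_1\cdots dz_N,\quad V_{ne}[\rho]=\int_{\mathbb{R}^3}v\rho\,dx,\quad V_{ee}[\rho_2]=\int_{\mathbb{R}^6}\frac{\rho_2(x,y)}{|x-y|}\,dx\,dy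 .$$ Optimal transportation functional with Coulomb cost: $E_{OT}[\rho]=\inf\int_{\mathbb{R}^6}\frac{1}{|x-y|}\,d\rho_2(x,y)$, the infimum being over nonnegative Radon measures $\rho_2$ on $\mathbb{R}^6$ such that $\frac{N}{\binom N2}$ times each of the two marginals of $\rho_2$ on $\mathbb{R}^3$ equals $\rho(x)\,dx$. Finally $E_0^{QM}=\inf_{\Psi\in\mathcal{A}}\{T[\Psi]+V_{ne}[\rho^\Psi]+V_{ee}[\rho_2^\Psi]\}$ and $E_0^{DFT-OT}=\inf_{\Psi\in\mathcal{A}}\{T[\Psi]+V_{ne}[\rho^\Psi]+E_{OT}[\rho^\Psi]\}$. *)

(* Defs.v *)
From HB Require Import structures.
From mathcomp Require Import all_boot all_order all_algebra all_fingroup.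
From mathcomp Require Import all_classical all_reals all_analysis.
From mathcomp Require Import complex.

Set Implicit Arguments.
Unset Strict Implicit.
Unset Printing Implicit Defensive.

Import Order.TTheory GRing.Theory Num.Theory.
Import numFieldNormedType.Exports.
Import ComplexField.Normc.

Local Open Scope classical_set_scope.
Local Open Scope ring_scope.
Local Open Scope complex_scope.

Definition tuple_of_pair (T : Type) (n : nat) (p : T * n.-tuple T) :
  n.+1.-tuple T := [the n.+1.-tuple T of p.1 :: p.2].

Lemma measurable_tuple_of_pair (d : measure_display) (T : measurableType d)
  (n : nat) : measurable_fun setT (@tuple_of_pair T n).
Proof.
by apply: measurable_cons; [exact: measurable_fst|exact: measurable_snd].
Qed.

(* The library has this only as a local lemma, and for mu \x nu it infers the
   sigma-finite structure of subprobabilities only. *)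
Lemma product_sigma_finite (d1 d2 : measure_display) (T1 : measurableType d1)
    (T2 : measurableType d2) (R : realType)
    (mu : {sigma_finite_measure set T1 -> \bar R})
    (nu : {sigma_finite_measure set T2 -> \bar R}) :
  sigma_finite setT (mu \x nu)%E.
Proof.
have /sigma_finiteP[F [TF ndF Foo]] := sigma_finiteT mu.
have /sigma_finiteP[G [TG ndG Goo]] := sigma_finiteT nu.
exists (fun n => F n `*` G n).
  rewrite -setXTT TF TG predeqE => -[x y]; split.
    move=> [/= [n _ Fnx] [k _ Gky]]; exists (maxn n k) => //; split.
    - by move: x Fnx; exact/subsetPset/ndF/leq_maxl.
    - by move: y Gky; exact/subsetPset/ndG/leq_maxr.
  by move=> [n _ []/= ? ?]; split; exists n.
move=> k; have [? ?] := Foo k; have [? ?] := Goo k.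
split; first exact: measurableX.
by rewrite product_measure1E// lte_mul_pinfty// ge0_fin_numE.
Qed.

Section cons_measure.
Local Open Scope ereal_scope.
Context (d : measure_display) (T : measurableType d) (R : realType) (n : nat).
Context (mu : {sigma_finite_measure set T -> \bar R}).
Context (nu : {sigma_finite_measure set (n.-tuple T) -> \bar R}).

(* the product measure mu \x nu, carried over to the tuples x :: t *)
Definition cons_measure : set (n.+1.-tuple T) -> \bar R :=
  pushforward (mu \x nu) (@tuple_of_pair T n).

Let cons_measure0 : cons_measure set0 = 0.
Proof. by rewrite /cons_measure /pushforward preimage_set0 measure0. Qed.

Let cons_measure_ge0 A : 0 <= cons_measure A.
Proof. by rewrite /cons_measure /pushforward measure_ge0. Qed.

Let cons_measure_sigma_additive : semi_sigma_additive cons_measure.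
Proof.
have mf := @measurable_tuple_of_pair d T n.
move=> F mF tF mUF; rewrite /cons_measure /pushforward preimage_bigcup.
apply: measure_semi_sigma_additive.
- by move=> k; rewrite -[X in measurable X]setTI; exact: mf.
- apply/trivIsetP => /= i j _ _ ij; rewrite -preimage_setI.
  by move/trivIsetP : tF => /(_ _ _ _ _ ij) ->//; rewrite preimage_set0.
- by rewrite -preimage_bigcup -[X in measurable X]setTI; exact: mf.
Qed.

HB.instance Definition _ := isMeasure.Build _ _ _ cons_measure
  cons_measure0 cons_measure_ge0 cons_measure_sigma_additive.

Let cons_measure_sigma_finite : sigma_finite setT cons_measure.
Proof.
have [F UF Foo] : sigma_finite setT (mu \x nu) by exact: product_sigma_finite.
pose g (t : n.+1.-tuple T) : T * n.-tuple T := (thead t, [tuple of behead t]).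
have mg : measurable_fun setT g.
  apply/measurable_fun_pair; first exact: measurable_tnth.
  exact: measurable_behead.
exists (fun k => g @^-1` F k).
  by rewrite -preimage_bigcup -UF preimage_setT.
move=> k; have [mFk Fkoo] := Foo k; split.
  by rewrite -[X in measurable X]setTI; exact: mg.
have gK p : g (tuple_of_pair p) = p.
  by case: p => x t; rewrite /g; congr pair; exact: val_inj.
rewrite /cons_measure /pushforward (_ : _ @^-1` _ = F k)//.
by apply/seteqP; split=> p /=; rewrite gK.
Qed.

HB.instance Definition _ := @Measure_isSigmaFinite.Build _ _ _ cons_measure
  cons_measure_sigma_finite.

End cons_measure.

Fixpoint power_measure (d : measure_display) (T : measurableType d)
    (R : realType) (mu : {sigma_finite_measure set T -> \bar R}) (n : nat) :
    {sigma_finite_measure set (n.-tuple T) -> \bar R} :=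
  if n is m.+1 then cons_measure mu (power_measure mu m)
  else @dirac _ (0.-tuple T) [tuple] R.

Section lebesgue3.
Context (R : realType).

(* The library's Lebesgue measure, with the Borel sets of R declared on R
   itself instead of on its alias measurableTypeR R. *)
Definition lebesgue1 : set R -> \bar R := @lebesgue_measure R.

HB.instance Definition _ := isMeasure.Build _ R R lebesgue1
  (measure0 (@lebesgue_measure R)) (measure_ge0 (@lebesgue_measure R))
  (@measure_semi_sigma_additive _ _ _ (@lebesgue_measure R)).

HB.instance Definition _ := @Measure_isSigmaFinite.Build _ R R lebesgue1
  (sigma_finiteT (@lebesgue_measure R)).

Definition lebesgue2 : set (R * R) -> \bar R := (lebesgue1 \x lebesgue1)%E.

HB.instance Definition _ := Measure.on lebesgue2.
HB.instance Definition _ := @Measure_isSigmaFinite.Build _ _ _ lebesgue2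
  (product_sigma_finite _ _).

Definition lebesgue3 : set (R * R * R) -> \bar R := (lebesgue2 \x lebesgue1)%E.

HB.instance Definition _ := Measure.on lebesgue3.
HB.instance Definition _ := @Measure_isSigmaFinite.Build _ _ _ lebesgue3
  (product_sigma_finite _ _).

End lebesgue3.

Notation R3 R := (R * R * R)%type.

Section wave_functions.
Context (R : realType) (N : nat).

Definition position_measure :
    {sigma_finite_measure set (N.-tuple (R3 R)) -> \bar R} :=
  power_measure (@lebesgue3 R) N.

Definition wave_function := N.-tuple (R3 R * 'Z_2) -> R[i].

(* (z_1, ..., z_N) with z_i = (x_i, s_i) *)
Definition configuration (x : N.-tuple (R3 R)) (s : N.-tuple 'Z_2) :
    N.-tuple (R3 R * 'Z_2) :=
  [tuple (tnth x i, tnth s i) | i < N].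

Definition L2norm (Psi : wave_function) : \bar R :=
  ((\sum_(s : N.-tuple 'Z_2)
     \int[position_measure]_x (normc (Psi (configuration x s)) ^+ 2)%:E)
   `^ 2^-1)%E.

Definition square_integrable (Psi : wave_function) : Prop :=
  (forall s,
     measurable_fun setT (fun x => complex.Re (Psi (configuration x s))) /\
     measurable_fun setT (fun x => complex.Im (Psi (configuration x s)))) /\
  (L2norm Psi < +oo)%E.

(* Smooth test functions live on the normed space of N x 3 matrices, whose
   i-th row is the position of the i-th particle. *)
Definition position_matrix (x : N.-tuple (R3 R)) : 'M[R]_(N, 3) :=
  \matrix_(i, k)
    tnth [tuple (tnth x i).1.1; (tnth x i).1.2; (tnth x i).2] k.

Definition partial (i : 'I_N) (k : 'I_3) (phi : 'M[R]_(N, 3) -> R) :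
    'M[R]_(N, 3) -> R :=
  fun x => 'D_(delta_mx i k) phi x.

Fixpoint C_ (n : nat) (phi : 'M[R]_(N, 3) -> R) : Prop :=
  continuous phi /\
  if n is m.+1 then
    forall i k, (forall x, derivable phi x (delta_mx i k)) /\
                C_ m (partial i k phi)
  else True.

Definition test_function (phi : 'M[R]_(N, 3) -> R) : Prop :=
  (forall n, C_ n phi) /\ compact (closure [set x | phi x != 0]).

Definition complex_integral (f : N.-tuple (R3 R) -> R[i]) : R[i] :=
  (\int[position_measure]_x complex.Re (f x)) +i*
  (\int[position_measure]_x complex.Im (f x)).

(* G i k is the weak derivative of Psi in the k-th coordinate of x_i *)
Definition weak_gradient (Psi : wave_function)
    (G : 'I_N -> 'I_3 -> wave_function) : Prop :=
  (forall i k, square_integrable (G i k)) /\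
  (forall i k s phi, test_function phi ->
    complex_integral (fun x => Psi (configuration x s) *
                               (partial i k phi (position_matrix x))%:C) =
    - complex_integral (fun x => G i k (configuration x s) *
                                 (phi (position_matrix x))%:C)).

(* The weak gradient is unique up to null sets; this picks a representative
   when there is one. *)
Definition gradient (Psi : wave_function) : 'I_N -> 'I_3 -> wave_function :=
  xget (fun _ _ _ => 0) [set G | weak_gradient Psi G].

Definition antisymmetric_wave (Psi : wave_function) : Prop :=
  forall (sigma : 'S_N) (s : N.-tuple 'Z_2),
    {ae position_measure, forall x,
      let z := configuration x s in
      Psi [tuple tnth z (sigma i) | i < N] = (-1) ^+ sigma * Psi z}.

Definition admissible : set wave_function :=
  [set Psi | [/\ square_integrable Psi,
                 exists G, weak_gradient Psi G,
                 L2norm Psi = 1%E &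
                 antisymmetric_wave Psi]].

Definition kinetic (Psi : wave_function) : \bar R :=
  ((2^-1)%:E * \sum_(s : N.-tuple 'Z_2) \int[position_measure]_x
     (\sum_(i < N) \sum_(k < 3)
        normc (gradient Psi i k (configuration x s)) ^+ 2)%:E)%E.

Definition rhoN (Psi : wave_function) (x : N.-tuple (R3 R)) : R :=
  \sum_(s : N.-tuple 'Z_2) normc (Psi (configuration x s)) ^+ 2.

(* The N-tuple listed by x; the padding by the point x0 is never reached when
   x has at least N elements. *)
Definition position_tuple (x0 : R3 R) (x : seq (R3 R)) : N.-tuple (R3 R) :=
  [tuple nth x0 x i | i < N].

Definition pair_density (Psi : wave_function) (xy : R3 R * R3 R) : \bar R :=
  ('C(N, 2)%:R%:E * \int[power_measure (@lebesgue3 R) (N - 2)]_t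
     (rhoN Psi (position_tuple xy.1 [:: xy.1, xy.2 & t]))%:E)%E.

Definition density (Psi : wave_function) (x : R3 R) : \bar R :=
  (N%:R%:E * \int[power_measure (@lebesgue3 R) (N - 1)]_t
     (rhoN Psi (position_tuple x (x :: t)))%:E)%E.

End wave_functions.

Section energies.
Context (R : realType).

Definition distance (x y : R3 R) : R :=
  Num.sqrt ((x.1.1 - y.1.1) ^+ 2 + (x.1.2 - y.1.2) ^+ 2 + (x.2 - y.2) ^+ 2).

(* The inverse is taken in \bar R, where 0^-1 = +oo. *)
Definition coulomb (xy : R3 R * R3 R) : \bar R :=
  ((distance xy.1 xy.2)%:E^-1)%E.

Definition Vne (v : R3 R -> R) (rho : R3 R -> \bar R) : \bar R :=
  (\int[@lebesgue3 R]_x ((v x)%:E * rho x))%E.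

Definition Vee (rho2 : R3 R * R3 R -> \bar R) : \bar R :=
  (\int[@lebesgue3 R \x @lebesgue3 R]_xy (rho2 xy * coulomb xy))%E.

(* No regularity clause is needed: on R^6 a Borel measure that is finite on
   compact sets is automatically regular. *)
Definition radon (gamma : {measure set (R3 R * R3 R) -> \bar R}) : Prop :=
  forall K : set (R3 R * R3 R), compact K -> (gamma K < +oo)%E.

Definition transport_plan (N : nat) (rho : R3 R -> \bar R) :
    set {measure set (R3 R * R3 R) -> \bar R} :=
  [set gamma | radon gamma /\
    forall A : set (R3 R), measurable A ->
      ((N%:R / 'C(N, 2)%:R)%:E * pushforward gamma fst A =
         \int[@lebesgue3 R]_(x in A) rho x /\
       (N%:R / 'C(N, 2)%:R)%:E * pushforward gamma snd A =
         \int[@lebesgue3 R]_(x in A) rho x)%E].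

Definition E_OT (N : nat) (rho : R3 R -> \bar R) : \bar R :=
  ereal_inf [set (\int[gamma]_xy coulomb xy)%E | gamma in transport_plan N rho].

Definition E0_QM (N : nat) (v : R3 R -> R) : \bar R :=
  ereal_inf [set (kinetic Psi + Vne v (density Psi) + Vee (pair_density Psi))%E
            | Psi in @admissible R N].

Definition E0_DFT_OT (N : nat) (v : R3 R -> R) : \bar R :=
  ereal_inf [set (kinetic Psi + Vne v (density Psi) + E_OT N (density Psi))%E
            | Psi in @admissible R N].

Definition L32_plus_Loo : set (R3 R -> R) :=
  [set v | exists v1 v2 : R3 R -> R,
    [/\ v1 \in Lfun (@lebesgue3 R) (3 / 2)%:E,
        v2 \in Lfun (@lebesgue3 R) +oo%E &
        v = v1 \+ v2]].

End energies.

(* Main.v *)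
(* For an admissible Psi the measure with density rho_2^Psi is a transport plan
   for rho^Psi, so that E_OT[rho^Psi] <= V_ee[rho_2^Psi]; adding T and V_ne and
   taking infima gives the bound. The first marginal of rho_2^Psi is a multiple
   of rho^Psi by Tonelli's theorem. The second one reduces to the first because
   antisymmetry makes rho_N^Psi almost everywhere invariant under exchanging
   x_1 and x_2. *)
Require Import Defs.
From HB Require Import structures.
From mathcomp Require Import all_boot all_order all_algebra all_fingroup.
From mathcomp Require Import all_classical all_reals all_analysis.
From mathcomp Require Import complex measurable_realfun.

Set Implicit Arguments.
Unset Strict Implicit.
Unset Printing Implicit Defensive.

Import Order.TTheory GRing.Theory Num.Theory.
Import ComplexField.Normc.
Import HBNNSimple.

Local Open Scope classical_set_scope.
Local Open Scope ring_scope.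
Local Open Scope ereal_scope.

(** * Nonnegative integrals and measures given by a density *)

(** A simple function below the restriction of [f] to [A] is below [f], so the bound comes straight
    from the supremum defining the integral, for an arbitrary set [A]; it will serve for compact
    sets. *)
Lemma ge0_integral_subset_le (d : measure_display) (T : measurableType d)
    (R : realType) (mu : {measure set T -> \bar R}) (f : T -> \bar R)
    (A : set T) : (forall x, 0 <= f x) ->
  \int[mu]_(x in A) f x <= \int[mu]_x f x.
Proof.
move=> f0; rewrite integral_mkcond !ge0_integralTE//; last first.
  by move=> x; rewrite patchE; case: ifP.
apply: le_ereal_sup => _ [h hf <-]; exists h => // x.
by apply: le_trans (hf x) _; rewrite patchE; case: ifP.
Qed.

(* Rewriting with [!] loops: the right-hand side is an instance of the left. *)
Lemma integral_indicM (d : measure_display) (T : measurableType d)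
    (R : realType) (mu : {measure set T -> \bar R}) (f : T -> \bar R)
    (A : set T) :
  \int[mu]_(x in A) f x = \int[mu]_x ((\1_A x)%:E * f x).
Proof.
rewrite integral_mkcond; apply: eq_integral => x _.
by rewrite epatch_indic/= muleC.
Qed.

Section density.
Context (d : measure_display) (T : measurableType d) (R : realType).
Context (mu : {measure set T -> \bar R}) (f : T -> \bar R).
Hypotheses (mf : measurable_fun setT f) (f0 : forall x, 0 <= f x).

(** The formula is kept for every set, measurable or not, so that it can be evaluated on compact
    sets as it stands. *)
Lemma density_measure_exists :
  exists nu : {measure set T -> \bar R},
    forall A, nu A = \int[mu]_(x in A) f x.
Proof.
pose nu A := \int[mu]_(x in A) f x.
have nu0 : nu set0 = 0 by rewrite /nu integral_set0.
have nu_ge0 A : 0 <= nu A by exact: integral_ge0.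
have nu_sigma : semi_sigma_additive nu.
  move=> F mF tF mUF; rewrite /nu ge0_integral_bigcup//.
    by apply: is_cvg_ereal_nneg_natsum => n _; exact: integral_ge0.
  exact: measurable_funTS.
pose nuM := isMeasure.Build _ _ _ nu nu0 nu_ge0 nu_sigma.
pose nu' : {measure set T -> \bar R} := HB.pack nu nuM.
by exists nu'.
Qed.

(** The left side is a supremum over simple [h] below [g], and the integral of each such [h] against
    [nu] equals that of [h * f] against [mu]. The one-sided bound suffices to compare a transport
    cost with the Coulomb energy. *)
Lemma ge0_integral_density_le (nu : {measure set T -> \bar R})
    (g : T -> \bar R) :
  (forall A, measurable A -> nu A = \int[mu]_(x in A) f x) ->
  measurable_fun setT g -> (forall x, 0 <= g x) ->
  \int[nu]_x g x <= \int[mu]_x (f x * g x).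
Proof.
move=> nuE mg g0; rewrite ge0_integralTE//; apply: ge_ereal_sup => _ [h hg <-].
have mh r : measurable_fun setT (fun x => (r * \1_(h @^-1` [set r]) x)%:E).
  by apply/measurable_EFinP; exact: measurable_funM.
rewrite sintegralE.
under eq_fsbigr => r _.
  rewrite nuE// integral_indicM.
  over.
(* As [h] is the finite sum of its values times the indicators of its level sets, the sum of
   integrals collapses to a single one. *)
suff -> : \sum_(r \in range h) r%:E * \int[mu]_x ((\1_(h @^-1` [set r]) x)%:E * f x) =
   \int[mu]_x ((h x)%:E * f x).
  apply: ge0_le_integral => //.
  - by move=> x _; rewrite mule_ge0// lee_fin.
  - by apply: emeasurable_funM => //; apply/measurable_EFinP.
  - by apply: emeasurable_funM.
  - by move=> x _; rewrite muleC lee_wpmul2l//.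
transitivity (\int[mu]_x (\sum_(r \in range h)
    ((r * \1_(h @^-1` [set r]) x)%:E * f x))); last first.
  apply: eq_integral => x _.
  rewrite -ge0_mule_fsuml; last by move=> y; exact: nnfun_muleindic_ge0.
  by rewrite fsumEFin// -fimfunE.
rewrite ge0_integral_fsum//; last 2 first.
- by move=> r; exact: emeasurable_funM.
- by move=> r x _; rewrite mule_ge0// nnfun_muleindic_ge0.
apply: eq_fsbigr => r /set_mem [x _ <-].
under [RHS]eq_integral do rewrite EFinM -muleA.
rewrite ge0_integralZl//.
- by apply: emeasurable_funM => //; apply/measurable_EFinP.
- by move=> y _; rewrite mule_ge0// lee_fin.
- by rewrite lee_fin.
Qed.

End density.

(** * Integration against power measures *)

Section power_measure.
Context (d : measure_display) (T : measurableType d) (R : realType).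
Context (mu : {sigma_finite_measure set T -> \bar R}).

(** The power measure on [n.+1] factors is by definition a pushforward of a product, so this is a
    change of variables followed by Tonelli. *)
Lemma ge0_integral_power_measureS (n : nat) (g : n.+1.-tuple T -> \bar R) :
  measurable_fun setT g -> (forall x, 0 <= g x) ->
  \int[power_measure mu n.+1]_x g x =
  \int[mu]_x \int[power_measure mu n]_t g (tuple_of_pair (x, t)).
Proof.
move=> mg g0; have mf := @measurable_tuple_of_pair d T n.
rewrite [LHS](_ : _ =
  \int[pushforward (mu \x power_measure mu n) (@tuple_of_pair T n)]_x g x)//.
rewrite ge0_integral_pushforward// preimage_setT fubini_tonelli1//.
  exact: measurableT_comp mf.
by move=> p /=.
Qed.

Lemma measurable_power_section (n : nat) (g : n.+1.-tuple T -> \bar R) :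
  measurable_fun setT g -> (forall x, 0 <= g x) ->
  measurable_fun setT (fun x =>
    \int[power_measure mu n]_t g (tuple_of_pair (x, t))).
Proof.
move=> mg g0; apply: (@measurable_fun_fubini_tonelli_F _ _ _ _ _
  (power_measure mu n) (g \o @tuple_of_pair T n)) => [|p /=] //.
by apply: measurableT_comp => //; exact: measurable_tuple_of_pair.
Qed.

Definition pair_tuple (n : nat) (p : T * T) (t : n.-tuple T) : n.+2.-tuple T :=
  tuple_of_pair (p.1, tuple_of_pair (p.2, t)).

Lemma measurable_pair_tuple (n : nat) (g : n.+2.-tuple T -> \bar R) :
  measurable_fun setT g ->
  measurable_fun setT (fun q : (T * T) * n.-tuple T => g (pair_tuple q.1 q.2)).
Proof.
move=> mg; apply: (measurableT_comp (g := fun q => pair_tuple q.1 q.2)) => //.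
apply: measurable_cons.
  exact: measurableT_comp measurable_fst measurable_fst.
apply: measurable_cons; last exact: measurable_snd.
exact: measurableT_comp measurable_snd measurable_fst.
Qed.

Lemma measurable_pair_section (n : nat) (g : n.+2.-tuple T -> \bar R) :
  measurable_fun setT g -> (forall x, 0 <= g x) ->
  measurable_fun setT (fun p => \int[power_measure mu n]_t g (pair_tuple p t)).
Proof.
move=> mg g0; apply: (@measurable_fun_fubini_tonelli_F _ _ _ _ _
  (power_measure mu n) (fun q => g (pair_tuple q.1 q.2))) => //.
exact: measurable_pair_tuple.
Qed.

(** Two coordinates are split off one at a time, and Tonelli on [T * T] merges them into the single
    variable [p], as in the pair density. *)
Lemma ge0_integral_power_measureSS (n : nat) (g : n.+2.-tuple T -> \bar R) :
  measurable_fun setT g -> (forall x, 0 <= g x) ->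
  \int[power_measure mu n.+2]_x g x =
  \int[mu \x mu]_p \int[power_measure mu n]_t g (pair_tuple p t).
Proof.
move=> mg g0; rewrite ge0_integral_power_measureS// fubini_tonelli1//.
- apply: eq_integral => x _; rewrite ge0_integral_power_measureS//.
  apply: (measurableT_comp mg).
  by apply: measurable_cons; [exact: measurable_cst|exact: measurable_id].
- exact: measurable_pair_section.
- by move=> p; exact: integral_ge0.
Qed.

(** Exchange of the first two entries, written with [tperm] to match the permutations of
    [antisymmetric_wave]. *)
Definition transpose (n : nat) (x : n.+2.-tuple T) : n.+2.-tuple T :=
  [tuple tnth x (tperm ord0 (lift ord0 ord0) i) | i < n.+2].

Lemma measurable_transpose (n : nat) : measurable_fun setT (@transpose n).
Proof.
apply/measurable_fun_tnthP => i.
rewrite (_ : _ \o _ = @tnth _ T ^~ (tperm ord0 (lift ord0 ord0) i)).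
  exact: measurable_tnth.
by apply/funext => x /=; rewrite tnth_mktuple.
Qed.

Lemma transpose_pair_tuple (n : nat) (x y : T) (t : n.-tuple T) :
  transpose (pair_tuple (x, y) t) = pair_tuple (y, x) t.
Proof.
apply: eq_from_tnth => i; rewrite tnth_mktuple.
(* The two exchanged indices compute; any other index reads the common tail [t], since [i0] and [i1]
   rule out 0 and 1. *)
case: tpermP => [->|->|i0 i1]//; rewrite !(tnth_nth x)/=.
case: i i0 i1 => -[|[|m]] im //= i0 i1; first by case: i0; exact: val_inj.
by case: i1; exact: val_inj.
Qed.

(** Tonelli in the two orders of integration; both factors carry the same measure. *)
Lemma ge0_integral_product_swap (G : T * T -> \bar R) :
  measurable_fun setT G -> (forall p, 0 <= G p) ->
  \int[mu \x mu]_p G (p.2, p.1) = \int[mu \x mu]_p G p.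
Proof.
move=> mG G0; rewrite [RHS]fubini_tonelli2//.
rewrite (@fubini_tonelli1 _ _ _ _ _ _ _ (fun p => G (p.2, p.1)))//.
apply: (measurableT_comp (g := fun p : T * T => (p.2, p.1)) mG).
apply/measurable_fun_pair; [exact: measurable_snd|exact: measurable_fst].
Qed.

(** Once the remaining coordinates are integrated out, this is the exchange of the two factors of
    [mu \x mu]. *)
Lemma ge0_integral_transpose (n : nat) (g : n.+2.-tuple T -> \bar R) :
  measurable_fun setT g -> (forall x, 0 <= g x) ->
  \int[power_measure mu n.+2]_x g (transpose x) =
  \int[power_measure mu n.+2]_x g x.
Proof.
move=> mg g0.
have mgt : measurable_fun setT (fun x => g (transpose x)).
  exact: (measurableT_comp mg (@measurable_transpose n)).
rewrite [RHS]ge0_integral_power_measureSS//.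
rewrite [LHS](ge0_integral_power_measureSS mgt); last by move=> x; exact: g0.
pose G p := \int[power_measure mu n]_t g (pair_tuple p t).
rewrite -[RHS](@ge0_integral_product_swap G); last 2 first.
- exact: measurable_pair_section.
- by move=> p; exact: integral_ge0.
apply: eq_integral => -[x y] _; apply: eq_integral => t _.
by rewrite transpose_pair_tuple.
Qed.

End power_measure.

(** * The N-particle position density *)

Section one_body_density.
Context (R : realType) (N : nat) (Psi : wave_function R N).

Lemma rhoN_ge0 x : (0 <= rhoN Psi x)%R.
Proof. by apply: sumr_ge0 => s _; exact: sqr_ge0. Qed.

Lemma sqr_normc (z : R[i]) :
  (normc z ^+ 2 = complex.Re z ^+ 2 + complex.Im z ^+ 2)%R.
Proof. by case: z => a b /=; rewrite sqr_sqrtr// addr_ge0// sqr_ge0. Qed.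

Lemma measurable_sqr_normc s : square_integrable Psi ->
  measurable_fun setT (fun x => normc (Psi (configuration x s)) ^+ 2)%R.
Proof.
move=> [/(_ s)[mRe mIm] _].
under eq_fun do rewrite sqr_normc.
by apply: measurable_funD; exact: measurable_funX.
Qed.

Lemma measurable_rhoN : square_integrable Psi ->
  measurable_fun setT (EFin \o rhoN Psi).
Proof.
move=> sPsi; apply/measurable_EFinP.
by apply: measurable_sum => s; exact: measurable_sqr_normc.
Qed.

Lemma integral_rhoN_lty : square_integrable Psi ->
  \int[position_measure R N]_x (rhoN Psi x)%:E < +oo.
Proof.
move=> sPsi; have [_] := sPsi.
under eq_integral do rewrite /rhoN -sumEFin.
rewrite ge0_integral_sum//; last 2 first.
- by move=> s; apply/measurable_EFinP; exact: measurable_sqr_normc.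
- by move=> s x _; rewrite lee_fin sqr_ge0.
move=> S12.
(* If this sum of integrals were infinite, so would be its square root [L2norm]. *)
rewrite ltey; apply/negP => /eqP Sy.
by move: S12; rewrite /L2norm eqy_poweR ?invr_gt0.
Qed.

(** The modulus removes the sign, and permuting the spins along with the positions only reorders the
    finite sum over spins. *)
Lemma rhoN_permute (sigma : 'S_N) : antisymmetric_wave Psi ->
  {ae position_measure R N, forall x,
    rhoN Psi [tuple tnth x (sigma i) | i < N] = rhoN Psi x}.
Proof.
move=> /(_ sigma) aPsi.
(* The exceptional null set depends on [s]; there are finitely many spin tuples, so one null set
   serves them all. *)
have {}aPsi : {ae position_measure R N, forall x, forall s : N.-tuple 'Z_2,
    let z := configuration x s in
    Psi [tuple tnth z (sigma i) | i < N] = (-1) ^+ sigma * Psi z}%R.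
  exact: filter_forall.
apply: filterS aPsi => x aPsi.
(* Antisymmetry permutes positions and spins together, [rhoN] only the positions; reindexing by [p]
   supplies the matching permutation of the spins. *)
pose p (s : N.-tuple 'Z_2) := [tuple tnth s (sigma i) | i < N].
have p_inj : injective p.
  move=> s s' ss'; apply: eq_from_tnth => i.
  have := congr1 (fun t => tnth t ((sigma^-1)%g i)) ss'.
  by rewrite !tnth_mktuple permKV.
rewrite /rhoN (reindex_inj p_inj); apply: eq_bigr => s _.
have -> : configuration [tuple tnth x (sigma i) | i < N] (p s) =
    [tuple tnth (configuration x s) (sigma i) | i < N].
  by apply: eq_from_tnth => i; rewrite !tnth_mktuple.
rewrite aPsi normcM; congr (_ ^+ 2)%R.
by case: (odd_perm sigma); rewrite ?expr0 ?expr1 ?normcN normc1 mul1r.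
Qed.

End one_body_density.

(** * Positivity and measurability of the Coulomb cost *)

Section coulomb.
Context (R : realType).

Lemma distance_ge0 (x y : R3 R) : (0 <= distance x y)%R.
Proof. exact: sqrtr_ge0. Qed.

Lemma coulomb_ge0 (xy : R3 R * R3 R) : 0 <= coulomb xy.
Proof. by rewrite /coulomb inve_ge0 lee_fin distance_ge0. Qed.

Lemma measurable_distance :
  measurable_fun setT (fun xy : R3 R * R3 R => distance xy.1 xy.2).
Proof.
have m1 : measurable_fun setT (@fst (R3 R) (R3 R)) by exact: measurable_fst.
have m2 : measurable_fun setT (@snd (R3 R) (R3 R)) by exact: measurable_snd.
have p11 : measurable_fun setT (fun x : R3 R => x.1.1).
  exact: measurableT_comp measurable_fst measurable_fst.
have p12 : measurable_fun setT (fun x : R3 R => x.1.2).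
  exact: measurableT_comp measurable_snd measurable_fst.
have p2 : measurable_fun setT (fun x : R3 R => x.2) by exact: measurable_snd.
have diff2 (p : R3 R -> R) : measurable_fun setT p ->
    measurable_fun setT (fun xy : R3 R * R3 R => (p xy.1 - p xy.2) ^+ 2)%R.
  move=> mp; apply: measurable_funX; apply: measurable_funB.
    exact: (measurableT_comp mp m1).
  exact: (measurableT_comp mp m2).
(* The square root becomes the power 1/2, a measurable real function. *)
rewrite /distance; under eq_fun do rewrite -powR12_sqrt ?addr_ge0 ?sqr_ge0//.
apply: (@measurableT_comp _ _ _ _ _ _ (@powR R ^~ 2^-1%R)) => //.
apply: measurable_funD; [apply: measurable_funD|].
- exact: (diff2 (fun x => x.1.1)).
- exact: (diff2 (fun x => x.1.2)).
- exact: (diff2 snd).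
Qed.

Lemma measurable_coulomb : measurable_fun setT (@coulomb R).
Proof.
(* The extended inverse is [+oo] on the diagonal and the real power -1 elsewhere, so measurability
   is checked branch by branch. *)
rewrite (_ : @coulomb R = fun xy => if distance xy.1 xy.2 == 0%R then +oo
    else (distance xy.1 xy.2 `^ (-1))%R%:E); last first.
  by apply/funext => xy; rewrite /coulomb /inve powR_inv1 ?distance_ge0.
apply: measurable_fun_ifT.
- by apply: measurable_fun_eqr => //; exact: measurable_distance.
- exact: measurable_cst.
- apply/measurable_EFinP.
  apply: (@measurableT_comp _ _ _ _ _ _ (@powR R ^~ (-1)%R)) => //.
  exact: measurable_distance.
Qed.

End coulomb.

(** * Integrals of the densities, and the marginals of the pair density *)

Section marginals.
Context (R : realType) (n : nat) (Psi : wave_function R n.+2).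
Let mu : {sigma_finite_measure set (R3 R) -> \bar R} := @lebesgue3 R.

Lemma position_tuple_cons (x0 x : R3 R) (t : n.+1.-tuple (R3 R)) :
  position_tuple n.+2 x0 (x :: t) = tuple_of_pair (x, t).
Proof.
by apply: eq_from_tnth => i; rewrite tnth_mktuple (tnth_nth x0).
Qed.

Lemma densityE (x : R3 R) :
  density Psi x = n.+2%:R%:E *
    \int[power_measure mu n.+1]_t (rhoN Psi (tuple_of_pair (x, t)))%:E.
Proof.
rewrite /density; have : (n.+2 - 1 = n.+1)%N by rewrite subn1.
(* The tuple type under the integral depends on [n.+2 - 1], hence the generalization to [m] before
   substituting. *)
move: (n.+2 - 1)%N => m ->; congr (_ * _).
by apply: eq_integral => t _; rewrite position_tuple_cons.
Qed.

Lemma pair_densityE (xy : R3 R * R3 R) :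
  pair_density Psi xy = 'C(n.+2, 2)%:R%:E *
    \int[power_measure mu n]_t (rhoN Psi (pair_tuple xy t))%:E.
Proof.
rewrite /pair_density; have : (n.+2 - 2 = n)%N by rewrite subn2.
move: (n.+2 - 2)%N => m ->; congr (_ * _); apply: eq_integral => t _.
by rewrite (position_tuple_cons _ _ (tuple_of_pair (xy.2, t))).
Qed.

Lemma pair_density_ge0 xy : 0 <= pair_density Psi xy.
Proof.
rewrite mule_ge0// ?lee_fin//; apply: integral_ge0 => t _.
by rewrite lee_fin rhoN_ge0.
Qed.

Hypothesis sPsi : square_integrable Psi.
Let F x := (rhoN Psi x)%:E.
Let F0 x : 0 <= F x. Proof. by rewrite lee_fin rhoN_ge0. Qed.
Let mF : measurable_fun setT F. Proof. exact: measurable_rhoN. Qed.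

Lemma measurable_pair_density : measurable_fun setT (pair_density Psi).
Proof.
rewrite (_ : pair_density Psi = fun xy => 'C(n.+2, 2)%:R%:E *
    \int[power_measure mu n]_t F (pair_tuple xy t)); last first.
  by apply/funext => xy; exact: pair_densityE.
by apply: measurable_funeM; exact: measurable_pair_section.
Qed.

(** The weight [w] covers two uses: [w = 1] gives the total mass, and indicators of the first or
    second point give the marginals. *)
Lemma integral_pair_density (w : R3 R * R3 R -> \bar R) :
  measurable_fun setT w -> (forall xy, 0 <= w xy) ->
  \int[mu \x mu]_xy (w xy * pair_density Psi xy) =
  'C(n.+2, 2)%:R%:E * \int[position_measure R n.+2]_x
    (w (tnth x ord0, tnth x (lift ord0 ord0)) * (rhoN Psi x)%:E).
Proof.
move=> mw w0.
have mwF : measurable_fun setT (fun x : n.+2.-tuple (R3 R) =>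
    w (tnth x ord0, tnth x (lift ord0 ord0)) * F x).
  apply: emeasurable_funM => //.
  apply: (measurableT_comp mw); apply/measurable_fun_pair;
    exact: measurable_tnth.
have mf : measurable_fun setT (fun xy =>
    \int[power_measure mu n]_t F (pair_tuple xy t)).
  exact: measurable_pair_section.
rewrite /position_measure (ge0_integral_power_measureSS _ mwF); last first.
  by move=> x; rewrite mule_ge0.
under eq_integral do rewrite pair_densityE muleCA.
rewrite ge0_integralZl//; last 2 first.
- exact: emeasurable_funM mw mf.
- by move=> xy _; rewrite mule_ge0//; apply: integral_ge0 => t _; exact: F0.
congr (_ * _); apply: eq_integral => -[x y] _.
rewrite -ge0_integralZl//; last by move=> t _; exact: F0.
apply: (measurableT_comp mF (f := F) (g := pair_tuple (x, y))).
apply: measurable_cons; first exact: measurable_cst.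
by apply: measurable_cons; [exact: measurable_cst|exact: measurable_id].
Qed.

(** One-body counterpart: both densities are thereby compared as N-particle integrals of [rhoN]. *)
Lemma integral_density (w : R3 R -> \bar R) :
  measurable_fun setT w -> (forall x, 0 <= w x) ->
  \int[mu]_x (w x * density Psi x) =
  n.+2%:R%:E * \int[position_measure R n.+2]_x
    (w (tnth x ord0) * (rhoN Psi x)%:E).
Proof.
move=> mw w0.
have mwF : measurable_fun setT (fun x : n.+2.-tuple (R3 R) =>
    w (tnth x ord0) * F x).
  apply: emeasurable_funM => //.
  by apply: (measurableT_comp mw); exact: measurable_tnth.
have mf : measurable_fun setT (fun x =>
    \int[power_measure mu n.+1]_t F (tuple_of_pair (x, t))).
  exact: measurable_power_section.
rewrite /position_measure (ge0_integral_power_measureS _ mwF); last first.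
  by move=> x; rewrite mule_ge0.
under eq_integral do rewrite densityE muleCA.
rewrite ge0_integralZl//; last 2 first.
- exact: emeasurable_funM mw mf.
- by move=> x _; rewrite mule_ge0//; apply: integral_ge0 => t _; exact: F0.
congr (_ * _); apply: eq_integral => x _.
rewrite -ge0_integralZl//; last by move=> t _; exact: F0.
apply: (measurableT_comp mF (f := F) (g := fun t => tuple_of_pair (x, t))).
by apply: measurable_cons; [exact: measurable_cst|exact: measurable_id].
Qed.

Lemma integral_pair_density_lty :
  \int[mu \x mu]_xy pair_density Psi xy < +oo.
Proof.
under eq_integral do rewrite -[pair_density _ _]mul1e.
rewrite (@integral_pair_density (cst 1))//.
under eq_integral do rewrite mul1e.
by rewrite lte_mul_pinfty// ?lee_fin// integral_rhoN_lty.
Qed.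

(** Both sides are [n.+2] times the integral of the indicator of [A] at the first particle against
    [rhoN]; the binomial prefactor of the pair density cancels. *)
Lemma pair_density_fst (A : set (R3 R)) : measurable A ->
  (n.+2%:R / 'C(n.+2, 2)%:R)%:E *
    \int[mu \x mu]_(xy in fst @^-1` A) pair_density Psi xy =
  \int[mu]_(x in A) density Psi x.
Proof.
move=> mA; rewrite [X in _ * X]integral_indicM [RHS]integral_indicM.
have mIA : measurable_fun setT (fun x : R3 R => (\1_A x)%:E : \bar R).
  by apply/measurable_EFinP.
rewrite integral_density// ?lee_fin//.
rewrite (@integral_pair_density (fun xy => (\1_A xy.1)%:E))//; last first.
  exact: (measurableT_comp mIA measurable_fst).
by rewrite muleA -EFinM divfK// pnatr_eq0 -lt0n bin_gt0.
Qed.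

Hypothesis aPsi : antisymmetric_wave Psi.

(** Here the indicator sits on the second particle; exchanging the first two particles preserves the
    measure and, almost everywhere, [rhoN]. *)
Lemma pair_density_snd (A : set (R3 R)) : measurable A ->
  (n.+2%:R / 'C(n.+2, 2)%:R)%:E *
    \int[mu \x mu]_(xy in snd @^-1` A) pair_density Psi xy =
  \int[mu]_(x in A) density Psi x.
Proof.
move=> mA; rewrite [X in _ * X]integral_indicM [RHS]integral_indicM.
have mIA : measurable_fun setT (fun x : R3 R => (\1_A x)%:E : \bar R).
  by apply/measurable_EFinP.
rewrite integral_density// ?lee_fin//.
rewrite (@integral_pair_density (fun xy => (\1_A xy.2)%:E))//; last first.
  exact: (measurableT_comp mIA measurable_snd).
rewrite muleA -EFinM divfK ?pnatr_eq0 -?lt0n ?bin_gt0//; congr (_ * _).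
have mAi i : measurable_fun setT (fun x : n.+2.-tuple (R3 R) =>
    (\1_A (tnth x i))%:E : \bar R).
  apply: (measurableT_comp (g := @tnth n.+2 (R3 R) ^~ i) mIA).
  exact: measurable_tnth.
pose G i (x : n.+2.-tuple (R3 R)) : \bar R := (\1_A (tnth x i))%:E * F x.
have mG i : measurable_fun setT (G i) by apply: emeasurable_funM.
have mGt : measurable_fun setT (G ord0 \o @transpose _ _ n).
  by apply: (measurableT_comp (mG ord0)); exact: measurable_transpose.
rewrite -[RHS](ge0_integral_transpose mu (mG ord0)); last first.
  by move=> x; rewrite mule_ge0// lee_fin.
apply: ge0_ae_eq_integral => //.
- exact: mG (lift ord0 ord0).
- by move=> x _; rewrite mule_ge0 ?lee_fin ?rhoN_ge0.
- by move=> x _; rewrite mule_ge0 ?lee_fin ?rhoN_ge0.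
(* Wherever the exchange fixes [rhoN], [G ord0] at the exchanged tuple is [G (lift ord0 ord0)] at
   the original one. *)
apply: filterS (rhoN_permute (tperm ord0 (lift ord0 ord0)) aPsi) => x Fx _.
by rewrite /G /F /= -Fx tnth_mktuple tpermL.
Qed.

End marginals.

(** * Comparison of the interaction energies *)

Lemma E_OT_le_Vee (R : realType) (n : nat) (Psi : wave_function R n.+2) :
  square_integrable Psi -> antisymmetric_wave Psi ->
  E_OT n.+2 (density Psi) <= Vee (pair_density Psi).
Proof.
move=> sPsi aPsi.
have mrho := measurable_pair_density sPsi.
have rho0 := pair_density_ge0 Psi.
have [gamma gammaE] :=
  density_measure_exists (@lebesgue3 R \x @lebesgue3 R) mrho rho0.
have : (transport_plan n.+2 (density Psi)) gamma.
  (* Finiteness on compact sets follows from the finite total mass of [gamma]. *)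
  split=> [K _|A mA].
    rewrite gammaE; apply: le_lt_trans (integral_pair_density_lty sPsi).
    exact: ge0_integral_subset_le.
  rewrite /pushforward !gammaE; split; first exact: pair_density_fst.
  exact: pair_density_snd.
move=> gamma_plan.
apply: (@le_trans _ _ (\int[gamma]_xy coulomb xy)).
  by apply: ereal_inf_lbound; exists gamma.
apply: ge0_integral_density_le => //.
- exact: measurable_coulomb.
- exact: coulomb_ge0.
Qed.

Theorem theorem5p1 (R : realType) (N : nat) (hN : (2 <= N)%N)
    (v : R3 R -> R) (hv : L32_plus_Loo v) :
  (E0_QM N v >= E0_DFT_OT N v)%E.
Proof.
(* Each [Psi] competing in [E0_QM] is also a competitor in [E0_DFT_OT], with a value that is no
   larger. *)
case: N hN => [|[|n]]// _; apply: le_ereal_inf_tmp => _ [Psi APsi <-].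
have [sPsi _ _ aPsi] := APsi; apply: ge_ereal_inf.
exists (kinetic Psi + Vne v (density Psi) + E_OT n.+2 (density Psi)).
  by exists Psi.
(* Addition is monotone on all of [\bar R], infinite values included. *)
by apply: leeD2l; exact: E_OT_le_Vee.
Qed.
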